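(* For every odd integer $m\ge 3$ there exists a cyclic $(4m+1,m,2,1)$-CEDF, i.e. a $(4m+1,m,2,1)$-CEDF over the cyclic group $\mathbb{Z}_{4m+1}$.
   Context: For subsets $A,B$ of an additive group $G$, $\Delta(A,B)$ denotes the multiset $\{a-b\mid a\in A,\ b\in B\}$. Let $G$ be an additive group of order $v$. A sequence $(A_0,\dots,A_{m-1})$ of $m\ge 2$ pairwise disjoint $\ell$-subsets of $G$ is a $(v,m,\ell,\lambda)$-CEDF (circular external difference family) over $G$ if the multiset union $\bigcup_{i\in\mathbb{Z}_m}\Delta(A_{i+1},A_i)$ (indices modulo $m$) equals $\lambda(G\setminus\{0\})$, i.e. contains each nonzero element of $G$ exactly $\lambda$ times and does not contain $0$. The CEDF is called cyclic if $G=\mathbb{Z}_v$. *)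

(* Defs.v *)
From HB Require Import structures.
From mathcomp Require Import all_boot all_order all_algebra.

Set Implicit Arguments.
Unset Strict Implicit.
Unset Printing Implicit Defensive.

Import GRing.Theory.
Local Open Scope ring_scope.

(* Finite multisets over G are represented by sequences, read up to order:
   the multiplicity of g in s is count_mem g s. *)
Definition Delta (G : finZmodType) (A B : {set G}) : seq G :=
  [seq a - b | a <- enum A, b <- enum B].

(* The multiset union, over i in Z_m, of Delta (A_(i+1), A_i); ordS i is the
   successor of i modulo m, and concatenation adds multiplicities. *)
Definition circular_differences (G : finZmodType) (m : nat)
    (A : 'I_m -> {set G}) : seq G :=
  flatten [seq Delta (A (ordS i)) (A i) | i <- enum 'I_m].

Definition is_CEDF (G : finZmodType) (v m l lambda : nat)
    (A : 'I_m -> {set G}) : Prop :=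
  [/\ #|G| = v,
      (2 <= m)%N,
      (forall i, #|A i| = l),
      (forall i j, i != j -> [disjoint A i & A j]) &
      (forall g : G, count_mem g (circular_differences A) =
                       if g == 0 then 0%N else lambda)].

Arguments is_CEDF {G} v m l lambda A.

(* Main.v *)
Require Import Defs.
From HB Require Import structures.
From mathcomp Require Import all_boot all_order all_algebra.
From mathcomp Require Import zify.

Set Implicit Arguments.
Unset Strict Implicit.
Unset Printing Implicit Defensive.

(** Throughout v = 4m+1. There are 4m differences in all, exactly as many as
    nonzero residues, so it is enough that every nonzero residue occurs as a
    difference ([CEDF_of_labels]).

    Two kinds of pairs do most of the work. A difference set between {x, x+1}
    and {y, y+2}, in either order, is an interval of four consecutive
    residues. The nonzero residues split into the m blocks
    {4k+1, ..., 4k+4}, k < m, and each step of a cycle alternating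
    between the two kinds could fill one block, but a cycle of odd length
    cannot alternate. Parity is repaired by three exceptional pairs S1, S2,
    S3: S1 and S3 have gap 4t, and S2 has gap 2m. The four steps

        {x, x+1} -> S1 -> S2 -> S3 -> {y, y+2}

    do not give intervals, but together they fill the four blocks q, q+t, q+h
    and q+h+t, where h = (m+1)/2. From S3 to {y, y+2} come the first and third
    members of blocks q and q+t; from {x, x+1} to S1, the last two members of
    blocks q+h and q+h+t. The fourth member of block q and the second of block
    q+h, at distance 4h-2 = 2m, come from S1 to the two labels of S2. The
    second member of block q and the first of block q+h, at distance
    4h-1 = 2m+1, come from the two labels of S2 to S3: passing to the other
    label now subtracts 2m, which is adding 2m+1 modulo v. The gap 4t
    of S1 and S3 repeats all this t blocks further on.

    The other m-4 blocks are filled by alternating pairs that zigzag between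
    low labels {4i, 4i+1}, moving up, and high labels {v-3-4s(i), v-1-4s(i)},
    moving down. The steps of the zigzag have block numbers i+s(i) and
    m-1-(i+s(i+1)). With s(i) = i they would run through the blocks 0, m-2, 2,
    m-4, ..., the even ones upwards and the odd ones downwards; a jump of s by
    2c skips 2c consecutive terms of this order. The four blocks to be skipped
    must therefore form one or two runs of even length there, each starting
    at an odd place (counted from 0). They do for t = 1 if m = 4q+3
    ([shift1], two jumps by 2) and for t = 2 if m = 4q+5 ([shift2], one jump
    by 4).

    Labels are kept apart by size and by their residues modulo 4
    ([zigzag_disjoint]). This needs q at least 2: for q = 1 the pair S1
    meets the first high pair. So m = 3, 5, 7, 9 are settled by explicit
    families. *)

(** * Families given by natural number labels *)

Definition label_set (m : nat) (L : nat -> seq nat) (i : 'I_m) :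
    {set 'Z_(4 * m + 1)} :=
  [set g : 'Z_(4 * m + 1) | (g : nat) \in L i].

(** Counting replaces uniqueness: the multiset of differences has 4m members,
    so once it covers the 4m nonzero residues it contains each exactly once
    and has no room for 0. *)
Lemma CEDF_of_labels (m : nat) (L : nat -> seq nat) :
    2 <= m ->
    (forall i, i < m -> [/\ size (L i) = 2, uniq (L i) &
                            forall a, a \in L i -> a < 4 * m + 1]) ->
    (forall i j a, i < m -> j < m -> a \in L i -> a \in L j -> i = j) ->
    (forall d, 0 < d < 4 * m + 1 -> exists i a b,
       [/\ i < m, a \in L i, b \in L (i.+1 %% m) &
           a + d = b \/ a + d = b + (4 * m + 1)]) ->
  is_CEDF (4 * m + 1) m 2 1 (label_set L : 'I_m -> _).
Proof.
move=> m2 Lok Ldisj Lcov.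
have ZpE : (Zp_trunc (4 * m + 1)).+2 = 4 * m + 1 by rewrite Zp_cast //; lia.
have cardA (i : 'I_m) : #|label_set L i| = 2.
  have [sz2 uL ltL] := Lok i (ltn_ord i).
  rewrite cardE -(size_map val); transitivity (size (L i)) => //.
  apply/perm_size/uniq_perm => //.
    by rewrite (map_inj_uniq val_inj) enum_uniq.
  move=> a; apply/mapP/idP => [[g gA ->]|aL].
    by rewrite mem_enum inE in gA.
  have av : a < (Zp_trunc (4 * m + 1)).+2 by rewrite ZpE ltL.
  by exists (Ordinal av) => //; rewrite mem_enum inE.
have sizeC : size (circular_differences (label_set L : 'I_m -> _)) = 4 * m.
  rewrite size_flatten /shape -map_comp sumnE big_map big_enum /=.
  under eq_bigr => i _ do rewrite /= size_allpairs -!cardE !cardA.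
  by rewrite sum_nat_const card_ord mulnC.
split => //.
- by rewrite card_ord ZpE.
- move=> i j neq_ij; apply/pred0P => g /=; apply/negP; rewrite !inE.
  move=> /andP[gi gj]; move/eqP: neq_ij; apply.
  exact/val_inj/(Ldisj _ _ _ (ltn_ord i) (ltn_ord j) gi gj).
set C := circular_differences _ in sizeC *.
pose N := rem (0%R : 'Z_(4 * m + 1)) (enum 'Z_(4 * m + 1)).
have uN : uniq N by rewrite rem_uniq ?enum_uniq.
have NE g : (g \in N) = (g != 0%R).
  by rewrite mem_rem_uniq ?enum_uniq // !inE mem_enum andbT.
have sizeN : size N = 4 * m.
  by rewrite size_rem ?mem_enum // -cardE card_ord ZpE addn1.
have sNC : {subset N <= C}.
  move=> g; rewrite NE => g0.
  have dlt : 0 < (g : nat) < 4 * m + 1.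
    by rewrite lt0n g0; apply: leq_trans (ltn_ord g) _; rewrite ZpE.
  have [i [a [b [im aL bL dE]]]] := Lcov _ dlt.
  have [_ _ lta] := Lok _ im.
  have ltb : b < 4 * m + 1.
    by case: (Lok (i.+1 %% m)) => [|_ _ lb]; [rewrite ltn_mod; lia|exact: lb].
  have av : a < (Zp_trunc (4 * m + 1)).+2 by rewrite ZpE lta.
  have bv : b < (Zp_trunc (4 * m + 1)).+2 by rewrite ZpE.
  apply/flattenP; exists (Delta (label_set L (ordS (Ordinal im)))
                            (label_set L (Ordinal im))).
    by apply/mapP; exists (Ordinal im); rewrite ?mem_enum.
  apply/allpairsP; exists (Ordinal bv, Ordinal av).
  rewrite !mem_enum !inE; split=> //=.
  apply/eqP; rewrite eq_sym GRing.subr_eq; apply/eqP/val_inj => /=.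
  rewrite addnC; case: dE => ->; first by rewrite modn_small.
  by rewrite -[in X in b + X]ZpE modnDr modn_small.
have eqNC : N =i C by apply: (uniq_min_size uN sNC _).2; rewrite sizeN sizeC.
have uC : uniq C by apply: (leq_size_uniq uN sNC); rewrite sizeN sizeC.
by move=> g; rewrite count_uniq_mem // -eqNC NE; case: eqP.
Qed.

(** * The zigzag with three closing pairs *)

(** Here v = 4m+1 and m = 2p+3, and the last three pairs are S1, S2 and S3.
    The cycle is translated so that, for q at least 2 and s(i) <= i+4, no label
    has to be reduced modulo v. *)
Definition zigzag (t q : nat) (s : nat -> nat) (n : nat) : seq nat :=
  let v := 16 * q + 8 * t + 5 in let p := 2 * q + t - 1 in
  if n < 2 * p then
    if odd n then [:: 4 * n./2; 4 * n./2 + 1]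
    else [:: v - 3 - 4 * s n./2; v - 1 - 4 * s n./2]
  else if n == 2 * p then [:: 4 * q - 5; 4 * q - 5 + 4 * t]
  else if n == 2 * p + 1 then [:: 8 * q + 4 * t - 1; v - 4]
  else [:: v - 4 * q - 4 - 4 * t; v - 4 * q - 4].

(** The five kinds of pairs, with the subtractions of the definition of
    [zigzag] carried out and the index solved for. *)
Variant zigzag_spec t q s n : seq nat -> Prop :=
  | ZigzagHigh i of i < 2 * q + t - 1 & n = 2 * i :
      zigzag_spec t q s n
        [:: 16 * q + 8 * t + 2 - 4 * s i; 16 * q + 8 * t + 4 - 4 * s i]
  | ZigzagLow i of i < 2 * q + t - 1 & n = 2 * i + 1 :
      zigzag_spec t q s n [:: 4 * i; 4 * i + 1]
  | ZigzagClose1 of n = 4 * q + 2 * t - 2 :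
      zigzag_spec t q s n [:: 4 * q - 5; 4 * q - 5 + 4 * t]
  | ZigzagClose2 of n = 4 * q + 2 * t - 1 :
      zigzag_spec t q s n [:: 8 * q + 4 * t - 1; 16 * q + 8 * t + 1]
  | ZigzagClose3 of n = 4 * q + 2 * t :
      zigzag_spec t q s n [:: 12 * q + 4 * t + 1; 12 * q + 8 * t + 1].

Lemma zigzagP t q s n : 0 < q -> n < 4 * q + 2 * t + 1 ->
  zigzag_spec t q s n (zigzag t q s n).
Proof.
move=> q0 nlt; rewrite /zigzag.
case: ltnP => np; first case: (boolP (odd n)) => odn.
- by apply: ZigzagLow; lia.
- have -> a : 16 * q + 8 * t + 5 - 3 - a = 16 * q + 8 * t + 2 - a by lia.
  have -> a : 16 * q + 8 * t + 5 - 1 - a = 16 * q + 8 * t + 4 - a by lia.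
  by apply: ZigzagHigh; lia.
case: eqP => e1; first by apply: ZigzagClose1; lia.
case: eqP => e2.
  have -> : 16 * q + 8 * t + 5 - 4 = 16 * q + 8 * t + 1 by lia.
  by apply: ZigzagClose2; lia.
have -> : 16 * q + 8 * t + 5 - 4 * q - 4 - 4 * t = 12 * q + 4 * t + 1 by lia.
have -> : 16 * q + 8 * t + 5 - 4 * q - 4 = 12 * q + 8 * t + 1 by lia.
by apply: ZigzagClose3; lia.
Qed.

Section Zigzag.

Variables (t q : nat) (s : nat -> nat).
Hypotheses (t_gt0 : 0 < t) (q_gt1 : 1 < q) (s0 : s 0 = 0).
Hypothesis s_incr : {homo s : i j / i < j}.
Hypothesis s_ub : forall i, s i <= i + 4.
(* Apart from the four blocks reserved for the closing pairs, each block is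
   met by a step from a high to a low pair or by a step from a low to the next
   high pair. *)
Hypothesis s_cover : forall k, k < 4 * q + 2 * t + 1 ->
  k \notin [:: q; q + t; 3 * q + t + 1; 3 * q + 2 * t + 1] ->
  (exists2 i, i < 2 * q + t - 1 & k = i + s i) \/
  (exists2 i, i.+1 < 2 * q + t - 1 & k + (i + s i.+1) = 4 * q + 2 * t).

Let m := 4 * q + 2 * t + 1.
Let Z := zigzag t q s.

Lemma zigzag_ok i : i < m ->
  [/\ size (Z i) = 2, uniq (Z i) & forall a, a \in Z i -> a < 4 * m + 1].
Proof.
rewrite /m /Z => im.
case: (zigzagP s (ltnW q_gt1) im) => [j jp _|j jp _|_|_|_];
  try have sj := s_ub j;
  (split=> [//||a]; [rewrite /= ?inE ?andbT; lia | rewrite !inE; lia]).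
Qed.

(** Since v is 1 modulo 4, the high labels are 0 or 2 modulo 4; the low ones
    are 0 or 1. The remaining labels are 3 modulo 4, or else 1 modulo 4 and
    larger than the low ones. High and low labels do not meet because
    s(i) <= i+4 keeps the high ones from 8q+4t-6 on, while the low ones end at
    8q+4t-7. *)
Lemma zigzag_disjoint i j a : i < m -> j < m ->
  a \in Z i -> a \in Z j -> i = j.
Proof.
rewrite /m /Z => im jm.
case: (zigzagP s (ltnW q_gt1) im) => [k kp ->|k kp ->|->|->|->];
  try have sk := s_ub k;
case: (zigzagP s (ltnW q_gt1) jm) => [l lp ->|l lp ->|->|->|->];
  try have sl := s_ub l;
  try (have s_kl := @s_incr k l; have s_lk := @s_incr l k);
  rewrite !inE; try lia.
Qed.

Definition covered d := exists i a b,
  [/\ i < m, a \in Z i, b \in Z (i.+1 %% m) &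
      a + d = b \/ a + d = b + (4 * m + 1)].

(** The flags b and c choose one label of each pair. Allowing j = 0 after the
    last index replaces the reduction modulo m by a linear side condition. *)
Lemma covered_step (b c : bool) i j x y x' y' d :
    (j = i.+1 /\ j < m) \/ (j = 0 /\ i.+1 = m) ->
    Z i = [:: x; y] -> Z j = [:: x'; y'] ->
    (if b then y else x) + d = (if c then y' else x') \/
    (if b then y else x) + d = (if c then y' else x') + (4 * m + 1) ->
  covered d.
Proof.
move=> ij Zi Zj E.
have [im {}ij] : i < m /\ i.+1 %% m = j.
  case: ij => [[-> jm]|[-> <-]]; first by rewrite modn_small ?(ltnW jm).
  by rewrite modnn.
exists i, (if b then y else x), (if c then y' else x').
by split; rewrite // ?ij ?Zi ?Zj; case: ifP; rewrite !inE eqxx ?orbT.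
Qed.

Lemma zigzag_high i : i < 2 * q + t - 1 -> Z (2 * i) =
  [:: 16 * q + 8 * t + 2 - 4 * s i; 16 * q + 8 * t + 4 - 4 * s i].
Proof.
move=> ip; have im : 2 * i < 4 * q + 2 * t + 1 by lia.
rewrite /Z; case: (zigzagP s (ltnW q_gt1) im) => [j _|j _|||]; try lia.
by move=> e; have -> : i = j by lia.
Qed.

Lemma zigzag_low i : i < 2 * q + t - 1 ->
  Z (2 * i + 1) = [:: 4 * i; 4 * i + 1].
Proof.
move=> ip; have im : 2 * i + 1 < 4 * q + 2 * t + 1 by lia.
rewrite /Z; case: (zigzagP s (ltnW q_gt1) im) => [j _|j _|||]; try lia.
by move=> e; have -> : i = j by lia.
Qed.

Lemma zigzag_close1 : Z (4 * q + 2 * t - 2) = [:: 4 * q - 5; 4 * q - 5 + 4 * t].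
Proof.
have im : 4 * q + 2 * t - 2 < 4 * q + 2 * t + 1 by lia.
by rewrite /Z; case: (zigzagP s (ltnW q_gt1) im) => // *; lia.
Qed.

Lemma zigzag_close2 :
  Z (4 * q + 2 * t - 1) = [:: 8 * q + 4 * t - 1; 16 * q + 8 * t + 1].
Proof.
have im : 4 * q + 2 * t - 1 < 4 * q + 2 * t + 1 by lia.
by rewrite /Z; case: (zigzagP s (ltnW q_gt1) im) => // *; lia.
Qed.

Lemma zigzag_close3 :
  Z (4 * q + 2 * t) = [:: 12 * q + 4 * t + 1; 12 * q + 8 * t + 1].
Proof.
have im : 4 * q + 2 * t < 4 * q + 2 * t + 1 by lia.
by rewrite /Z; case: (zigzagP s (ltnW q_gt1) im) => // *; lia.
Qed.

Lemma zigzag_cover d : 0 < d < 4 * m + 1 -> covered d.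
Proof.
move=> dv; set k := d.-1 %/ 4; set r := d.-1 %% 4.
(* The residue d is member r, counted from 0, of block k. *)
have dE : d = 4 * k + r.+1 by rewrite /k /r; lia.
have r4 : r < 4 by rewrite ltn_mod.
have km : k < 4 * q + 2 * t + 1 by move: dv; rewrite /m /k; lia.
move: k r dE r4 km dv => k r -> {d} r4 km _.
case: (boolP (k \in [:: q; q + t; 3 * q + t + 1; 3 * q + 2 * t + 1])) => [|kN].
  rewrite !inE => kS.
  have Z0 : Z 0 = [:: 16 * q + 8 * t + 2; 16 * q + 8 * t + 4].
    by rewrite -[0](muln0 2) zigzag_high ?s0 ?muln0 ?subn0 //; lia.
  have pp : 2 * q + t - 2 < 2 * q + t - 1 by lia.
  have ZP := zigzag_low pp.
  have gap01 b c d ij :=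
    @covered_step b c _ _ _ _ _ _ d ij ZP zigzag_close1.
  have gap12 b c d ij :=
    @covered_step b c _ _ _ _ _ _ d ij zigzag_close1 zigzag_close2.
  have gap23 b c d ij :=
    @covered_step b c _ _ _ _ _ _ d ij zigzag_close2 zigzag_close3.
  have gap30 b c d ij :=
    @covered_step b c _ _ _ _ _ _ d ij zigzag_close3 Z0.
  rewrite /m in gap01 gap12 gap23 gap30.
  (* Four members for each of the blocks q, q+t, q+h and q+h+t in turn. *)
  case/or4P: kS => /eqP->; case: r r4 => [|[|[|[|//]]]] _.
  - by apply: (gap30 true false); lia.
  - by apply: (gap23 false false); lia.
  - by apply: (gap30 true true); lia.
  - by apply: (gap12 true false); lia.
  - by apply: (gap30 false false); lia.
  - by apply: (gap23 false true); lia.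
  - by apply: (gap30 false true); lia.
  - by apply: (gap12 false false); lia.
  - by apply: (gap23 true false); lia.
  - by apply: (gap12 true true); lia.
  - by apply: (gap01 true false); lia.
  - by apply: (gap01 false false); lia.
  - by apply: (gap23 true true); lia.
  - by apply: (gap12 false true); lia.
  - by apply: (gap01 true true); lia.
  - by apply: (gap01 false true); lia.
case: (s_cover km kN) => [[i ip kE] | [i ip kE]].
  have sb := s_ub i.
  have gap b c d ij :=
    @covered_step b c _ _ _ _ _ _ d ij (zigzag_high ip) (zigzag_low ip).
  rewrite /m in gap; case: r r4 => [|[|[|[|//]]]] _.
  - by apply: (gap true false); lia.
  - by apply: (gap true true); lia.
  - by apply: (gap false false); lia.
  - by apply: (gap false true); lia.
have sb := s_ub i.+1.
have gap b c d ij :=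
    @covered_step b c _ _ _ _ _ _ d ij (zigzag_low (ltnW ip)) (zigzag_high ip).
rewrite /m in gap; case: r r4 => [|[|[|[|//]]]] _.
- by apply: (gap true false); lia.
- by apply: (gap false false); lia.
- by apply: (gap true true); lia.
- by apply: (gap false true); lia.
Qed.

(** What remains is the choice of s, a question about block numbers only:
    skip exactly the four reserved blocks. *)
Theorem CEDF_zigzag : is_CEDF (4 * m + 1) m 2 1 (label_set Z : 'I_m -> _).
Proof.
apply: CEDF_of_labels; first by rewrite /m; lia.
- exact: zigzag_ok.
- exact: zigzag_disjoint.
- exact: zigzag_cover.
Qed.

End Zigzag.

(** * Skipping the reserved blocks *)

(** In the order 0, m-2, 2, m-4, ... of the blocks, the reserved ones q, q+1,
    3q+2, 3q+3 for m = 4q+3 form two adjacent couples, at the places q-1, q,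
    3q+1, 3q+2 if q is even and q, q+1, 3q+2, 3q+3 if q is odd. The zigzag
    skips a couple at each jump. *)
Definition shift1 q i := i + 2 * (q <= 2 * i) + 2 * (3 * q <= 2 * i).

(** For m = 4q+5 the reserved blocks q, q+2, 3q+3, 3q+5 occupy four
    consecutive places of the same order, starting at q-1 if q is even and at
    3q+2 if q is odd. *)
Definition shift2 q i := i + 4 * ((if odd q then 3 * q + 3 else q) <= 2 * i).

(** The witnesses invert i |-> i + shift1 q i on each of the three stretches
    between jumps; an odd block k has place m-1-k. *)
Lemma CEDF_3mod4 q (m := 4 * q + 3) : 1 < q ->
  exists A : 'I_m -> {set 'Z_(4 * m + 1)}, is_CEDF (4 * m + 1) m 2 1 A.
Proof.
move=> q1; have mE : m = 4 * q + 2 * 1 + 1 by rewrite /m; lia.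
rewrite mE; exists (label_set (zigzag 1 q (shift1 q))).
apply: CEDF_zigzag => //.
- by rewrite /shift1; lia.
- by move=> i j; rewrite /shift1; lia.
- by move=> i; rewrite /shift1; lia.
move=> k km kN; rewrite !inE in kN.
have [ok|ek] := boolP (odd k); last first.
  have [kq|kq] := leqP k q; last have [kq'|kq'] := leqP k (3 * q + 2).
  - by left; exists k./2; rewrite /shift1; lia.
  - by left; exists (k./2 - 1); rewrite /shift1; lia.
  - by left; exists (k./2 - 2); rewrite /shift1; lia.
have [kq|kq] := leqP k q; last have [kq'|kq'] := leqP k (3 * q + 2).
- by right; exists (2 * q - 2 - k./2); rewrite /shift1; lia.
- by right; exists (2 * q - 1 - k./2); rewrite /shift1; lia.
- by right; exists (2 * q - k./2); rewrite /shift1; lia.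
Qed.

Lemma CEDF_1mod4 q (m := 4 * q + 5) : 1 < q ->
  exists A : 'I_m -> {set 'Z_(4 * m + 1)}, is_CEDF (4 * m + 1) m 2 1 A.
Proof.
move=> q1; have mE : m = 4 * q + 2 * 2 + 1 by rewrite /m; lia.
rewrite mE; exists (label_set (zigzag 2 q (shift2 q))).
apply: CEDF_zigzag => //.
- by rewrite /shift2; case: ifP; lia.
- by move=> i j; rewrite /shift2; case: ifP; lia.
- by move=> i; rewrite /shift2; case: ifP; lia.
move=> k km kN; rewrite !inE in kN; rewrite /shift2.
case: (boolP (odd q)) => oq; case: (boolP (odd k)) => ok.
- have [kq|kq] := leqP k q.
  + by right; exists (2 * q - 1 - k./2); lia.
  + by right; exists (2 * q + 1 - k./2); lia.
- have [kq|kq] := leqP k (3 * q + 2).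
  + by left; exists k./2; lia.
  + by left; exists (k./2 - 2); lia.
- have [kq|kq] := leqP k (3 * q + 4).
  + by right; exists (2 * q - 1 - k./2); lia.
  + by right; exists (2 * q + 1 - k./2); lia.
- have [kq|kq] := leqP k q.
  + by left; exists k./2; lia.
  + by left; exists (k./2 - 2); lia.
Qed.

(** * The families for m < 10 *)

(** A decision procedure for the hypotheses of [CEDF_of_labels]. *)
Definition table_CEDF (m : nat) (T : seq (seq nat)) : bool :=
  let L := nth [::] T in
  [&& all (fun i => [&& size (L i) == 2, uniq (L i) &
                        all (gtn (4 * m + 1)) (L i)]) (iota 0 m),
      all (fun i => all (fun j => (i == j) || ~~ has (mem (L i)) (L j))
                        (iota 0 m)) (iota 0 m) &
      all (fun d => has (fun i => has (fun a => has (fun b =>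
             (a + d == b) || (a + d == b + (4 * m + 1)))
           (L (i.+1 %% m))) (L i)) (iota 0 m)) (iota 1 (4 * m))].

Lemma CEDF_of_table m T : 2 <= m -> table_CEDF m T ->
  exists A : 'I_m -> {set 'Z_(4 * m + 1)}, is_CEDF (4 * m + 1) m 2 1 A.
Proof.
move=> m2 /and3P[/allP ok /allP disj /allP cov].
exists (label_set (nth [::] T)); apply: CEDF_of_labels => //.
- move=> i im; have /ok /and3P[/eqP-> -> /allP lt] : i \in iota 0 m.
    by rewrite mem_iota.
  by split.
- move=> i j a im jm ai aj.
  have /disj /allP/(_ j) : i \in iota 0 m by rewrite mem_iota.
  rewrite mem_iota => /(_ jm) /orP[/eqP//|/hasPn/(_ a aj)/=].
  by rewrite ai.
- move=> d dv; have /cov /hasP[i] : d \in iota 1 (4 * m).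
    by rewrite mem_iota add1n -[(4 * m).+1]addn1.
  rewrite mem_iota => im /hasP[a ai /hasP[b bj dE]].
  by exists i, a, b; split=> //; case/orP: dE => /eqP; auto.
Qed.

Theorem theorem3p1 (m : nat) (hm : (3 <= m)%N) (modd : odd m) :
  exists A : 'I_m -> {set 'Z_(4 * m + 1)},
    is_CEDF (4 * m + 1) m 2 1 A.
Proof.
have [m10|m10] := ltnP m 10; last first.
  have [q q1 [->|->]] : exists2 q, 1 < q & m = 4 * q + 3 \/ m = 4 * q + 5.
    by have [m3|m3] := eqVneq (m %% 4) 3;
      [exists (m %/ 4) | exists (m %/ 4 - 1)]; lia.
  - exact: CEDF_3mod4.
  - exact: CEDF_1mod4.
have : m \in [:: 3; 5; 7; 9] by rewrite !inE; lia.
rewrite !inE => /or4P[]/eqP->.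
- by apply: (@CEDF_of_table _ [:: [:: 0; 1]; [:: 2; 11]; [:: 7; 10]]).
- by apply: (@CEDF_of_table _ [:: [:: 0; 2]; [:: 11; 12]; [:: 6; 10];
    [:: 14; 3]; [:: 16; 20]]).
- by apply: (@CEDF_of_table _ [:: [:: 0; 2]; [:: 23; 24]; [:: 8; 10];
    [:: 15; 16]; [:: 6; 14]; [:: 18; 3]; [:: 20; 28]]).
- by apply: (@CEDF_of_table _ [:: [:: 0; 2]; [:: 7; 8]; [:: 33; 35];
    [:: 15; 16]; [:: 25; 27]; [:: 19; 20]; [:: 6; 18]; [:: 22; 3];
    [:: 24; 36]]).
Qed.
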